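(* The prime subshift $X_{\mathcal P} \subset \{0,1\}^{\mathbb{Z}}$ contains either a nonzero finite point or a cluster fractal.
   Context: The prime subshift $X_{\mathcal P}$ is the subshift whose language contains $w = w_0\cdots w_{|w|-1} \in \{0,1\}^*$ if and only if for infinitely many $n \in \mathbb{N}$ we have: for all $a \in [0,|w|-1]$, $n+a$ is prime $\iff w_a = 1$. That is, $X_{\mathcal P}$ is the set of $x\in\{0,1\}^{\mathbb{Z}}$ all of whose finite subwords have this property. A finite point is a configuration with only finitely many nonzero symbols. The shift is $\sigma^v(x)_u = x_{u+v}$. Cluster fractals (in $\mathbb{Z}^d$, here $d=1$, alphabet $\Sigma=\{0,1\}$). Use $d(\mathbf u,\mathbf v) = \max_i |\mathbf u_i - \mathbf v_i|$, and let $B_r(S)$ be the set of cells at distance at most $r$ from $S$. A pattern is a function $P : D(P) \to \Sigma$ with $D(P) \subset \mathbb{Z}^d$; its support $S(P)$ is the set of cells of $D(P)$ where $P$ is nonzero. A set $S$ is $r$-connected if the graph on $S$ with edges between cells at distance at most $r$ is connected. $P$ is $r$-padded if $D(P) \supset B_r(S(P))$. An $r$-cluster is an $r$-padded pattern (with nonempty support) whose support is $r$-connected and all of whose zero cells are at distance at most $r$ from the support. $R$ is a zero-gluing of patterns $P$, $Q$ if $D(R) = D(P)\cup D(Q)$, $R|_{D(P)} = P$, $R|_{D(Q)} = Q$, and $P$, $Q$ are both $0$ on $D(P)\cap D(Q)$ (similarly for finitely many patterns). $P|_{\mathbb{Z}^d}$ is the configuration agreeing with $P$ on $D(P)$ and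 $0$ elsewhere. A configuration $x$ is a cluster fractal if it is not all-zero and there are $r_1 < r_2 < \cdots$ in $\mathbb{N}$ and, for each $i$, a finite set $B_i$ of finite $r_i$-clusters such that for all $i$: (1) each cluster in $B_{i+1}$ is obtained by zero-gluing translates of clusters in $B_i$ and adding the $r_{i+1}$-padding by zeroes; (2) each cluster in $B_{i+1}$ contains a translate of every cluster in $B_i$; (3) each cluster in $B_{i+1}$ contains at least two translates of clusters in $B_i$ with disjoint supports; and (4) $x = \lim_{j\to\infty} \sigma^{\mathbf v_j}(b_j|_{\mathbb{Z}^d})$ for some sequences $\mathbf v_j \in \mathbb{Z}^d$, $b_j \in B_j$. *)

(* Defs.v *)
From mathcomp Require Import all_boot all_order all_algebra.
From mathcomp Require Import boolp classical_sets functions cardinality filter.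
From mathcomp Require Import topology.

Set Implicit Arguments.
Unset Strict Implicit.
Unset Printing Implicit Defensive.

Import Order.TTheory GRing.Theory Num.Theory.

Local Open Scope classical_set_scope.
Local Open Scope ring_scope.

(* The symbol 1 is [true] and the symbol 0 is [false]; the space of
   configurations carries the product of the discrete topologies. *)
Definition config := {ptws int -> bool}.

Definition shift_by (v : int) (x : config) : config := fun u => x (u + v).

Definition config_support (x : config) : set int := [set u | x u].

Definition finite_point (x : config) : Prop := finite_set (config_support x).

Definition nonzero (x : config) : Prop := exists u, x u.

Definition prime_word (w : seq bool) : Prop :=
  infinite_set
    [set n : nat | forall a : nat, (a < size w)%N ->
                     (prime (n + a)%N <-> nth false w a = true)].

Definition subword (x : config) (m : int) (l : nat) : seq bool :=
  mkseq (fun k => x (m + k%:Z)) l.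

Definition prime_subshift : set config :=
  [set x | forall m l, prime_word (subword x m l)].

(* A pattern, as a partial function: [P u = None] when [u] is outside the
   domain. Domains may be infinite. *)
Definition pattern := int -> option bool.

Definition dom (P : pattern) : set int := [set u | P u <> None].

Definition supp (P : pattern) : set int := [set u | P u = Some true].

Definition ball_around (r : nat) (S : set int) : set int :=
  [set u | exists2 s, S s & `|u - s| <= r%:Z].

Definition r_connected (r : nat) (S : set int) : Prop :=
  forall u v, S u -> S v ->
    exists p : seq int,
      [/\ path (fun a b : int => `|a - b| <= r%:Z) u p,
          last u p = v &
          forall w, w \in p -> S w].

Definition r_padded (r : nat) (P : pattern) : Prop :=
  ball_around r (supp P) `<=` dom P.

Definition r_cluster (r : nat) (P : pattern) : Prop :=
  [/\ supp P !=set0,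
      r_padded r P,
      r_connected r (supp P) &
      forall u, P u = Some false -> ball_around r (supp P) u].

Definition finite_pattern (P : pattern) : Prop := finite_set (dom P).

Definition translate (v : int) (P : pattern) : pattern := fun u => P (u - v).

Definition contains (Q P : pattern) : Prop := forall u, dom P u -> Q u = P u.

Definition zero_gluing (k : nat) (P : 'I_k -> pattern) (R : pattern) : Prop :=
  [/\ dom R = \bigcup_i dom (P i),
      forall i, contains R (P i) &
      forall i j u, i != j -> dom (P i) u -> dom (P j) u ->
        P i u = Some false /\ P j u = Some false].

Definition pad_zeroes (r : nat) (P : pattern) : pattern := fun u =>
  if P u is Some b then Some b
  else if `[< ball_around r (supp P) u >] then Some false else None.

Definition extend_by_zero (P : pattern) : config := fun u => odflt false (P u).

Definition cluster_fractal (x : config) : Prop :=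
  nonzero x /\
  exists (r : nat -> nat) (B : nat -> set pattern),
  [/\ forall i, (r i < r i.+1)%N,
      forall i, finite_set (B i) /\
        forall b, B i b -> r_cluster (r i) b /\ finite_pattern b &
  [/\ forall i c, B i.+1 c ->
        exists (k : nat) (b : 'I_k -> pattern) (v : 'I_k -> int) (R : pattern),
          [/\ forall j, B i (b j),
              zero_gluing (fun j => translate (v j) (b j)) R &
              c = pad_zeroes (r i.+1) R],
      forall i c, B i.+1 c ->
        forall b, B i b -> exists v, contains c (translate v b),
      forall i c, B i.+1 c ->
        exists b1 b2 v1 v2,
          [/\ B i b1 /\ B i b2,
              contains c (translate v1 b1),
              contains c (translate v2 b2) &
              supp (translate v1 b1) `&` supp (translate v2 b2) = set0] &
      exists (v : nat -> int) (b : nat -> pattern),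
        (forall j, B j (b j)) /\
        (fun j => shift_by (v j) (extend_by_zero (b j))) @ \oo --> x]].

(* Main.v *)
Require Import Defs.
From mathcomp Require Import all_boot all_order all_algebra.
From mathcomp Require Import boolp classical_sets functions cardinality filter.
From mathcomp Require Import topology zify.

Set Implicit Arguments.
Unset Strict Implicit.
Unset Printing Implicit Defensive.

Import Order.TTheory GRing.Theory Num.Theory.

Local Open Scope classical_set_scope.
Local Open Scope ring_scope.
Implicit Types (x y z : config) (S : set int) (P : pattern).

(** The primes enter through three facts: the set [prime_subshift] is closed
    and shift-invariant; it has a nonzero point, since there are infinitely
    many primes (shift the indicator of the primes so that a large prime sits
    at 0 and pass to a limit); and it is [sparse], because [0^N] occurs just
    after every positive multiple of [(N+1)!], hence with bounded gaps in every point.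
    The dichotomy holds for every subshift with these three properties
    ([finite_point_or_cluster_fractal]).

    Suppose that there is no nonzero finite point. By compactness and Zorn's
    lemma, there is a subshift [Y] minimal among those having a nonzero point
    ([minimal_nonzero_subshift]); in [Y] every nonzero point has a dense orbit.
    For a radius [r], cut the support of a point of [Y] into its classes for
    the relation [linked], that is, into its maximal [r]-connected parts.
    Sparseness bounds the diameter of these parts uniformly, so that up to
    translation [Y] has only finitely many [r]-clusters. Two compactness
    arguments give a uniform distance within which every 1 of every point of
    [Y] sees
    - a copy of every [r]-cluster of [Y], as all nonzero orbits are dense
      ([visit_bound]);
    - a 1 outside its own [r]-connected part, as no nonzero point is finite
      ([recurrence_bound]).
    With [r'] beyond this distance, every [r']-cluster of [Y] contains all the
    [r]-clusters of [Y], and two [r]-clusters with disjoint supports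
    ([next_radius_exists]); it is always a zero-gluing of [r]-clusters
    ([gluing_of_clusters]). Iterating [r |-> r'] gives radii whose sets of all
    clusters of [Y] witness that every [x] in [Y] with [x 0 = 1] is a cluster
    fractal: the clusters around 0 in [x] itself converge to [x]. *)

(** * Agreement on windows and limits along ultrafilters *)

Definition agree (N : nat) (x y : config) : Prop :=
  forall u : int, `|u| <= N%:Z -> x u = y u.

Lemma agree_sym N x y : agree N x y -> agree N y x.
Proof. by move=> h u /h. Qed.

Lemma agree_trans N x y z : agree N x y -> agree N y z -> agree N x z.
Proof. by move=> h k u uN; rewrite h ?k. Qed.

Lemma agree_shift N (v : int) x y :
  agree (N + `|v|%N) x y -> agree N (shift_by v x) (shift_by v y).
Proof. by move=> h u uN; apply: h; lia. Qed.

Lemma shift_by_shift v w x : shift_by v (shift_by w x) = shift_by (v + w) x.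
Proof. by apply/funext => u; rewrite /shift_by addrA. Qed.

Lemma shift_by0 x : shift_by 0 x = x.
Proof. by apply/funext => u; rewrite /shift_by addr0. Qed.

(** Compactness of the space of configurations: the limit is decided cell by
    cell, and a window has finitely many cells. Limits along one ultrafilter
    can be taken for several families at once, which replaces the extraction
    of common subsequences. *)
Lemma ultra_limit T (U : set_system T) (x : T -> config) :
  UltraFilter U -> exists y, forall N, U [set t | agree N (x t) y].
Proof.
move=> UU; exists (fun u => `[< U [set t | x t u] >]) => N.
have pt u : U [set t | x t u = `[< U [set t | x t u] >]].
  have [Uu|Uu] := in_ultra_setVsetC [set t | x t u] UU.
    by apply: filterS (Uu) => t /= ->; rewrite asboolT.
  apply: filterS (Uu) => t /= /negP/negbTE ->; rewrite asboolF // => Uu'.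
  by apply: (@filter_not_empty _ U); apply: filterS (filterI Uu Uu') => s [].
have : U [set t | forall i : 'I_(N + N).+1,
          x t (i%:Z - N%:Z) = `[< U [set t | x t (i%:Z - N%:Z)] >]].
  by apply: filter_forall => i; exact: pt.
apply: filterS => t h u uN /=.
have iN : (absz (u + N%:Z)%R < (N + N).+1)%N by lia.
have := h (Ordinal iN); rewrite /=.
by have -> : (absz (u + N%:Z))%:Z - N%:Z = u by lia.
Qed.

Lemma ultra_oo : exists U : set_system nat, UltraFilter U /\ \oo `<=` U.
Proof. exact: ultraFilterLemma. Qed.

(** * Subshifts and minimality *)

(** The first field is closedness in the product topology: the windows form a
    basis of neighbourhoods. *)
Record subshift (X : set config) : Prop := Subshift {
  subshift_closed : forall y, (forall N, exists2 x, X x & agree N x y) -> X y;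
  subshift_shift : forall v x, X x -> X (shift_by v x) }.

Lemma subshift_ultra T (U : set_system T) (x : T -> config) X :
  subshift X -> UltraFilter U -> U [set t | X (x t)] ->
  exists2 y, X y & forall N, U [set t | agree N (x t) y].
Proof.
move=> sX UU UX; have [y hy] := ultra_limit x UU; exists y => //.
apply: (subshift_closed sX) => N.
by have [t [/= Xt ht]] := filter_ex (filterI UX (hy N)); exists (x t).
Qed.

Definition orbit_closure (x : config) : set config :=
  [set y | forall N, exists v, agree N (shift_by v x) y].

Lemma orbit_closure_subshift x : subshift (orbit_closure x).
Proof.
split=> [y h N|v y h N].
  have [z /(_ N)[v zv] zy] := h N.
  by exists v; exact: agree_trans zv zy.
have [w hw] := h (N + `|v|)%N; exists (v + w).
by rewrite -shift_by_shift; exact: agree_shift.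
Qed.

Lemma orbit_closure_id x : orbit_closure x x.
Proof. by move=> N; exists 0; rewrite shift_by0. Qed.

Lemma orbit_closure_sub X x : subshift X -> X x -> orbit_closure x `<=` X.
Proof.
move=> sX Xx y h; apply: (subshift_closed sX) => N.
by have [v hv] := h N; exists (shift_by v x) => //; exact: (subshift_shift sX).
Qed.

(** Zorn's lemma, applied to the removed parts [F] of the subshifts [X `\` F]
    having a point with a 1 at 0. A union of a chain of such [F] is again one:
    the conditions 'belongs to [X `\` F] and has a 1 at 0', for [F] in the
    chain, generate a proper filter, and a limit along a finer ultrafilter
    satisfies them all. When the complement of [F] is minimal, an orbit
    closure of a point with a 1 at 0 cannot be a smaller subshift. *)
Lemma minimal_nonzero_subshift X : subshift X -> (exists2 x, X x & x 0) ->
  exists Y, [/\ subshift Y, Y `<=` X, exists2 x, Y x & x 0 &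
    forall x y, Y x -> Y y -> x 0 -> orbit_closure x y].
Proof.
move=> sX [x0 Xx0 x00].
pose P F := subshift (X `\` F) /\ exists2 x, (X `\` F) x & x 0.
have [F [[sF nF] maxF]] : exists F, P F /\ forall G, F `<` G -> ~ P G.
  apply: Zorn_bigcup => C CP Ctot; split.
    split=> [y h|v x [Xx nx]].
      split=> [|[F CF Fy]].
        apply: (subshift_closed sX) => N.
        by have [x [Xx _] xy] := h N; exists x.
      have [sF _] := CP _ CF.
      suff : (X `\` F) y by case.
      apply: (subshift_closed sF) => N.
      have [x [Xx nx] xy] := h N; exists x => //; split=> // Fx.
      by apply: nx; exists F.
    split; first exact: (subshift_shift sX).
    move=> [F CF Fx]; have [sF _] := CP _ CF.
    suff : (X `\` F) (shift_by v x) by case.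
    by apply: (subshift_shift sF); split=> // Fx'; apply: nx; exists F.
  (* The empty chain has no filter base; its union removes nothing from X. *)
  have [[G CG]|C0] := pselect (exists G, C G); last first.
    exists x0 => //; split=> // -[F CF _]; apply: C0; by exists F.
  pose B F := [set x : config | (X `\` F) x /\ x 0].
  have pF : ProperFilter (filter_from C B).
    apply: filter_from_proper => [|F /CP[_ [x]]]; last by exists x.
    apply: filter_from_filter; first by exists G.
    move=> F F' CF CF'; have [s|s] := Ctot _ _ CF CF'.
      by exists F' => // x [[Xx nx] x00']; split; split=> //; split=> // /s.
    by exists F => // x [[Xx nx] x00']; split; split=> //; split=> // /s.
  have [U [UU sU]] := ultraFilterLemma pF.
  have UB F : C F -> U (B F) by move=> CF; apply: sU; exists F.
  have [y hy] := ultra_limit id UU.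
  exists y.
    split.
      apply: (subshift_closed sX) => N.
      have [x [[[Xx _] _] xy]] := filter_ex (filterI (UB _ CG) (hy N)).
      by exists x.
    move=> [F CF Fy]; have [sF _] := CP _ CF.
    suff : (X `\` F) y by case.
    apply: (subshift_closed sF) => N.
    have [x [[XFx _] xy]] := filter_ex (filterI (UB _ CF) (hy N)).
    by exists x.
  have [x [[_ x00'] xy]] := filter_ex (filterI (UB _ CG) (hy 0%N)).
  by rewrite -(xy 0).
exists (X `\` F); split=> // x y Fx Fy x00'.
have sub := orbit_closure_sub sF Fx.
apply: contrapT => nxy; apply: (maxF (F `|` ~` orbit_closure x)).
  by split=> [z Fz|/(_ y)]; [left|case: Fy => _ nFy h; apply: nFy; apply: h; right].
rewrite /P; have -> : X `\` (F `|` ~` orbit_closure x) = orbit_closure x.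
  apply/seteqP; split=> z /= => [[_ nz]|oz].
    by apply: contrapT => noz; apply: nz; right.
  by have [Xz nFz] := sub _ oz; split=> // -[].
split; first exact: orbit_closure_subshift.
by exists x => //; exact: orbit_closure_id.
Qed.

(** * Connected parts of the support *)

(** For [x p], the [r]-connected component of [p] in the support of [x], built
    from [p] by jumps of length at most [r]. *)
Inductive linked (r : nat) (x : config) (p : int) : int -> Prop :=
| linked_refl : linked r x p p
| linked_step u v : linked r x p u -> `|u - v| <= r%:Z -> x v -> linked r x p v.

Lemma linked_trans r x p q s : linked r x p q -> linked r x q s -> linked r x p s.
Proof. by move=> pq; elim=> // u v _ pu uv xv; exact: linked_step pu uv xv. Qed.

Lemma linked_on r x p s : x p -> linked r x p s -> x s.
Proof. by move=> xp; case. Qed.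

Lemma linked_sym r x p s : x p -> linked r x p s -> linked r x s p.
Proof.
move=> xp; elim=> [|u v pu up uv xv]; first exact: linked_refl.
apply: linked_trans up.
apply: linked_step (linked_refl _ _ _) _ (linked_on xp pu).
by rewrite distrC.
Qed.

Lemma linkedW r r' x p s : (r <= r')%N -> linked r x p s -> linked r' x p s.
Proof.
move=> rr; elim=> [|u v _ pu uv xv]; first exact: linked_refl.
by apply: linked_step pu _ xv; lia.
Qed.

Lemma linked_shift r x p s v :
  linked r (shift_by v x) (p - v) (s - v) <-> linked r x p s.
Proof.
have shift w y q t : linked r y q t -> linked r (shift_by w y) (q - w) (t - w).
  elim=> [|a b _ qa ab yb]; first exact: linked_refl.
  by apply: linked_step qa _ _; [lia|rewrite /shift_by subrK].
split; last exact: shift.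
by move/(shift (- v)); rewrite shift_by_shift addNr shift_by0 !opprK !subrK.
Qed.

Lemma linked_path r x p s : linked r x p s ->
  exists q : seq int, [/\ path (fun a b : int => `|a - b| <= r%:Z) p q,
    last p q = s & forall w, w \in q -> linked r x p w].
Proof.
elim=> [|u v pu [q [pq qu qp]] uv xv]; first by exists [::].
exists (rcons q v); rewrite last_rcons rcons_path pq qu uv; split=> // w.
rewrite mem_rcons inE => /orP[/eqP ->|/qp] //.
exact: linked_step pu uv xv.
Qed.

(** A jump of length at most [r] cannot cross [r] consecutive zeros. *)
Lemma linked_below r x (p s t : int) : p < t ->
  (forall u, t <= u < t + r%:Z -> ~~ x u) -> linked r x p s -> s < t.
Proof.
move=> pt z; elim=> // u v _ ut uv xv.
by have := z v; rewrite xv; lia.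
Qed.

Lemma linked_above r x (p s t : int) : t + r%:Z <= p ->
  (forall u, t <= u < t + r%:Z -> ~~ x u) -> linked r x p s -> t + r%:Z <= s.
Proof.
move=> pt z; elim=> // u v _ ut uv xv.
by have := z v; rewrite xv; lia.
Qed.

(** The all-zero point is then the only point that can be uniformly recurrent:
    long blocks of zeros occur everywhere, with bounded gaps. *)
Definition sparse (X : set config) : Prop := forall N : nat, exists M : nat,
  forall x, X x -> forall m : int, exists t, m <= t < m + M%:Z /\
    forall u, t <= u < t + N%:Z -> ~~ x u.

Lemma linked_bounded X r : sparse X -> exists K : nat, forall x p s,
  X x -> linked r x p s -> `|s - p| <= K%:Z.
Proof.
move=> /(_ r)[M hM]; exists (M + r)%N => x p s Xx ps.
have [t [t1 /linked_below/(_ ps) h1]] := hM x Xx (p + 1).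
have [t' [t2 /linked_above/(_ ps) h2]] := hM x Xx (p - (M + r)%N%:Z).
by lia.
Qed.

(** * Clusters cut out of a configuration *)

(** Clusters of radius [r], as well as their gluings before the outer padding
    is added, are all of this form, for [S] a union of connected parts. *)
Definition window (r : nat) (S : set int) (x : config) : pattern :=
  fun u => if `[< ball_around r S u >] then Some (x u) else None.

Definition cluster_at (r : nat) (x : config) (p : int) : pattern :=
  window r [set s | linked r x p s] x.

Lemma ball_around_id r S : S `<=` ball_around r S.
Proof. by move=> s Ss; exists s; rewrite // subrr. Qed.

Lemma windowT r S x u : ball_around r S u -> window r S x u = Some (x u).
Proof. by move=> b; rewrite /window asboolT. Qed.

Lemma windowF r S x u : ~ ball_around r S u -> window r S x u = None.
Proof. by move=> b; rewrite /window asboolF. Qed.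

Lemma dom_window r S x : dom (window r S x) = ball_around r S.
Proof.
apply/seteqP; split=> u; rewrite /dom /=.
  by move=> h; apply: contrapT => /windowF.
by move/windowT => ->.
Qed.

Lemma contains_window r r' S S' x : ball_around r S `<=` ball_around r' S' ->
  contains (window r' S' x) (window r S x).
Proof. by move=> sub u; rewrite dom_window => Su; rewrite !windowT //; exact: sub. Qed.

Lemma supp_window r S x : S `<=` x -> ball_around r S `&` x `<=` S ->
  supp (window r S x) = S.
Proof.
move=> Sx xS; apply/seteqP; split=> u; rewrite /supp /=.
  by have [b|b] := pselect (ball_around r S u);
    [rewrite windowT // => -[xu]; apply: xS|rewrite windowF].
by move=> Su; rewrite windowT ?(Sx u Su) //; exact: ball_around_id.
Qed.

(** The padding of a connected part consists of zeros: a 1 within distance [r]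
    of the part would belong to it. *)
Lemma ball_linked r r' x p u : (r <= r')%N ->
  ball_around r [set s | linked r' x p s] u -> x u -> linked r' x p u.
Proof.
by move=> rr [s ps us] xu; apply: linked_step ps _ xu; lia.
Qed.

Lemma supp_linked_window r r' x p : x p -> (r <= r')%N ->
  supp (window r [set s | linked r' x p s] x) = [set s | linked r' x p s].
Proof.
move=> xp rr; apply: supp_window => [s|s []] /=; first exact: linked_on.
exact: ball_linked.
Qed.

Lemma supp_cluster r x p : x p -> supp (cluster_at r x p) = [set s | linked r x p s].
Proof. by move=> xp; exact: supp_linked_window. Qed.

Lemma cluster_at_cluster r x p : x p -> r_cluster r (cluster_at r x p).
Proof.
move=> xp; rewrite /r_cluster /r_padded supp_cluster //; split.
- by exists p; exact: linked_refl.
- by rewrite dom_window.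
- move=> u v /= pu pv.
  have [q [uq qv qu]] := linked_path (linked_trans (linked_sym xp pu) pv).
  by exists q; split=> // w /qu; exact: linked_trans.
- move=> u h; apply: contrapT => /windowF h'.
  by move: h; rewrite /cluster_at h'.
Qed.

Lemma translate_cluster r x p :
  translate p (cluster_at r (shift_by p x) 0) = cluster_at r x p.
Proof.
apply/funext => u; rewrite /translate /cluster_at /window /shift_by subrK.
congr (if _ then _ else _); apply: asbool_equiv_eq.
split=> -[s /= ps us].
  exists (s + p); last by lia.
  by apply/(@linked_shift r x p _ p); rewrite subrr addrK.
exists (s - p); last by lia.
by rewrite /= -(subrr p); apply/linked_shift.
Qed.

Lemma translate0 P : translate 0 P = P.
Proof. by apply/funext => u; rewrite /translate subr0. Qed.

Lemma contains_cluster r r' x p q : (r <= r')%N -> linked r' x p q ->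
  contains (cluster_at r' x p) (cluster_at r x q).
Proof.
move=> rr pq; apply: contains_window => u [s qs us].
by exists s; [exact: linked_trans pq (linkedW rr qs)|lia].
Qed.

Lemma finite_bounded (A : set int) (K : nat) :
  (forall u, A u -> `|u| <= K%:Z) -> finite_set A.
Proof.
move=> AK; apply: (@sub_finite_set _ _ ((fun i => i%:Z - K%:Z) @` `I_(K + K).+1)).
  move=> u /AK uK; exists (absz (u + K%:Z)%R) => /=; lia.
exact/finite_image/finite_II.
Qed.

(** Such a pattern is a word of length [2K+1] over the three-letter alphabet
    [option bool]. *)
Lemma finite_patterns (K : nat) :
  finite_set [set P : pattern | forall u, dom P u -> `|u| <= K%:Z].
Proof.
pose g (f : {ffun 'I_(K + K).+1 -> option bool}) : pattern := fun u =>
  if `|u| <= K%:Z then f (inord (absz (u + K%:Z)%R)) else None.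
apply: (@sub_finite_set _ _ (g @` [set: _])); last exact/finite_image/finite_finset.
move=> P PK; exists [ffun i : 'I_(K + K).+1 => P (i%:Z - K%:Z)] => //.
apply/funext => u; rewrite /g; case: ifPn => [uK|uK]; last first.
  by case E: (P u) => //; case/negP: uK; apply: PK; rewrite /dom /= E.
rewrite ffunE inordK; last by lia.
by congr P; lia.
Qed.

(** The support of an [r']-cluster splits into [r]-connected parts, and the
    [r]-paddings of two different parts can meet only in zeros. One translated
    [r]-cluster is taken for each part, centered at a chosen representative of
    the part so as to count no part twice. Boundedness makes the number of
    parts finite. *)
Lemma gluing_of_clusters r r' (Y : set config) (x : config) K : (r <= r')%N ->
  subshift Y -> Y x -> x 0 ->
  (forall s, linked r' x 0 s -> `|s| <= K%:Z) ->
  exists (k : nat) (b : 'I_k -> pattern) (v : 'I_k -> int) (R : pattern),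
    [/\ forall j, exists2 y, Y y /\ y 0 & b j = cluster_at r y 0,
        zero_gluing (fun j => translate (v j) (b j)) R &
        cluster_at r' x 0 = pad_zeroes r' R].
Proof.
move=> rr sY Yx x0 sK.
have /finite_seqP[l hl] : finite_set [set s | linked r' x 0 s].
  exact: finite_bounded sK.
have memP s : s \in l <-> linked r' x 0 s by rewrite -[linked _ _ _ _]/([set s | linked r' x 0 s] s) hl.
(* [rep] depends only on the set of cells linked to [s], hence is constant on
   each connected part. *)
pose rep s := xget 0 [set t | linked r x s t].
have repP s : linked r x s (rep s).
  by apply: (@xgetPex _ 0 [set t | linked r x s t]); exists s; exact: linked_refl.
have rep_eq s t : x s -> linked r x s t -> rep s = rep t.
  move=> xs st; rewrite /rep; congr xget; apply/seteqP; split=> w /=.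
    by apply: linked_trans; exact: linked_sym.
  exact: linked_trans.
pose m := undup (map rep l).
have mP j : exists2 s, m`_(j : 'I_(size m)) = rep s & linked r' x 0 s.
  have : m`_j \in m by apply: mem_nth.
  by rewrite mem_undup => /mapP[s /memP ? ->]; exists s.
have m0 (j : 'I_(size m)) : linked r' x 0 m`_j.
  by have [s -> ls] := mP j; exact: linked_trans ls (linkedW rr (repP s)).
have mx (j : 'I_(size m)) : x m`_j by exact: linked_on (m0 j).
have mrep (j : 'I_(size m)) : rep m`_j = m`_j.
  have [s -> ls] := mP j; apply/esym/rep_eq; last exact: repP.
  exact: linked_on ls.
exists (size m), (fun j => cluster_at r (shift_by m`_j x) 0), (fun j => m`_j).
exists (window r [set s | linked r' x 0 s] x); split.
- move=> j; exists (shift_by m`_j x) => //; split.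
    exact: (subshift_shift sY).
  by rewrite /shift_by add0r.
- rewrite /zero_gluing; under eq_bigcupr do rewrite translate_cluster dom_window.
  rewrite dom_window; split.
  + apply/seteqP; split=> u; last first.
      move=> [j _ [s ps us]]; exists s => //.
      exact: linked_trans (m0 j) (linkedW rr ps).
    move=> [s /= ls us].
    have rm : rep s \in m by rewrite mem_undup; apply/map_f/memP.
    have jm : (index (rep s) m < size m)%N by rewrite index_mem.
    exists (Ordinal jm) => //; exists s => //=; rewrite nth_index //.
    by apply: linked_sym (repP s); exact: linked_on ls.
  + move=> j; rewrite translate_cluster; apply: contains_window => u [s ps us].
    by exists s => //; exact: linked_trans (m0 j) (linkedW rr ps).
  + move=> i j u ij; rewrite !translate_cluster !dom_window => ui uj.
    rewrite /cluster_at !windowT //; suff -> : x u = false by [].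
    apply/negbTE/negP => xu; case/eqP: ij; apply/val_inj/eqP.
    rewrite -(nth_uniq 0 (ltn_ord i) (ltn_ord j) (undup_uniq _)).
    rewrite -(mrep i) -(mrep j); apply/eqP.
    by rewrite (rep_eq _ _ (mx i) (ball_linked (leqnn r) ui xu))
               (rep_eq _ _ (mx j) (ball_linked (leqnn r) uj xu)).
(* Beyond the r-padding, every cell of the r'-padding carries a zero. *)
- apply/funext => u; rewrite /pad_zeroes supp_linked_window //.
  have [b|b] := pselect (ball_around r [set s | linked r' x 0 s] u).
    rewrite windowT // /cluster_at windowT //.
    by case: b => s ? us; exists s => //; lia.
  rewrite (windowF _ b) /cluster_at /window; case: asboolP => // b'.
  case xu: (x u) => //; case: b; apply: ball_around_id.
  exact: ball_linked b' xu.
Qed.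

(** * Uniform bounds in a minimal subshift *)

(** Otherwise there are counterexamples with arbitrarily large [R]; in the
    limit they give points [x] and [y] of [Y] with [x 0], such that [y] is not
    in the orbit closure of [x]. *)
Lemma visit_bound Y K : subshift Y ->
  (forall x y, Y x -> Y y -> x 0 -> orbit_closure x y) ->
  exists R : nat, forall x y, Y x -> Y y -> x 0 ->
    exists2 v : int, `|v| <= R%:Z & agree K (shift_by v x) y.
Proof.
move=> sY minY; apply: contrapT => noR.
have /choice[f fP] R : exists xy : config * config,
    [/\ Y xy.1, Y xy.2, xy.1 0 & forall v : int, `|v| <= R%:Z ->
      ~ agree K (shift_by v xy.1) xy.2].
  apply: contrapT => nxy; apply: noR; exists R => x y Yx Yy x0.
  apply: contrapT => nv; apply: nxy; exists (x, y); split=> // v vR h.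
  by apply: nv; exists v.
have [U [UU ooU]] := ultra_oo.
have everywhere (Q : nat -> Prop) : (forall n, Q n) -> U Q.
  by move=> h; apply: filterS filterT => n _; exact: h.
have [x Yx hx] : exists2 x, Y x & forall N, U [set n | agree N (f n).1 x].
  by apply: subshift_ultra => //; apply: everywhere => n; have [] := fP n.
have [y Yy hy] : exists2 y, Y y & forall N, U [set n | agree N (f n).2 y].
  by apply: subshift_ultra => //; apply: everywhere => n; have [] := fP n.
have x0 : x 0.
  have [n /= <- //] := filter_ex (hx 0%N).
  by have [] := fP n.
have [v xy] := minY _ _ Yx Yy x0 K.
have Uv : U [set n | (`|v| <= n)%N] by apply: ooU; exact: nbhs_infty_ge.
have [n [[/= fx fy] vn]] :=
  filter_ex (filterI (filterI (hx (K + `|v|)%N) (hy K)) Uv).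
have [_ _ _ /(_ v)] := fP n; apply; first by lia.
apply: agree_trans (agree_shift fx) _.
by apply: agree_trans xy _; exact: agree_sym.
Qed.

(** Otherwise a limit of counterexamples is a point of [Y] that has a 1 at 0
    and vanishes outside [[-K, K]], that is, a nonzero finite point. *)
Lemma recurrence_bound Y K : subshift Y ->
  (forall x, Y x -> finite_point x -> ~ nonzero x) ->
  exists R : nat, forall x, Y x -> x 0 ->
    exists q : int, [/\ K%:Z < `|q|, `|q| <= R%:Z & x q].
Proof.
move=> sY nofin; apply: contrapT => noR.
have /choice[f fP] R : exists x : config,
    [/\ Y x, x 0 & forall q : int, K%:Z < `|q| -> `|q| <= R%:Z -> ~ x q].
  apply: contrapT => nx; apply: noR; exists R => x Yx x0.
  apply: contrapT => nq; apply: nx; exists x; split=> // q Kq qR xq.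
  by apply: nq; exists q.
have [U [UU ooU]] := ultra_oo.
have [x Yx hx] : exists2 x, Y x & forall N, U [set n | agree N (f n) x].
  apply: subshift_ultra => //; apply: filterS filterT => n _ /=.
  by have [] := fP n.
apply: (nofin x Yx).
  apply: (@finite_bounded _ K) => q xq; rewrite leNgt; apply/negP => Kq.
  have Uq : U [set n | (`|q| <= n)%N] by apply: ooU; exact: nbhs_infty_ge.
  have [n [/= fx qn]] := filter_ex (filterI (hx `|q|%N) Uq).
  have [_ _ /(_ q Kq)] := fP n; apply; first by lia.
  by rewrite fx //; lia.
exists 0; have [n /= <- //] := filter_ex (hx 0%N).
by have [] := fP n.
Qed.

(** What passing from one level of the fractal to the next requires of the
    radii: each [r']-cluster contains every [r]-cluster, and at least two
    different [r]-connected parts. *)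
Definition next_radius Y (r r' : nat) : Prop := (r < r')%N /\
  forall x, Y x -> x 0 ->
    (forall y, Y y -> y 0 ->
      exists v, contains (cluster_at r' x 0) (translate v (cluster_at r y 0))) /\
    exists q, linked r' x 0 q /\ ~ linked r x 0 q.

(** With [K] bounding the [r]-connected parts, a padded [r]-cluster fits in a
    window of radius [K + r]. The bound [R1] is for copies of such windows and
    [R2] for a 1 too far from 0 to be [r]-linked to it; [r'] exceeds both, so
    the window and that 1 are reached from 0 in a single jump. *)
Lemma next_radius_exists Y r : subshift Y -> sparse Y ->
  (forall x y, Y x -> Y y -> x 0 -> orbit_closure x y) ->
  (forall x, Y x -> finite_point x -> ~ nonzero x) ->
  exists r', next_radius Y r r'.
Proof.
move=> sY spY minY nofin.
have [K hK] := linked_bounded r spY.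
have [R1 hR1] := visit_bound (K + r + r) sY minY.
have [R2 hR2] := recurrence_bound K sY nofin.
exists (r + K + R1 + R2).+1; split; first by lia.
move=> x Yx x0; split=> [y Yy y0|].
  have [v vR xy] := hR1 x y Yx Yy x0; exists v => u.
  have agr (s : int) : `|s - v| <= (K + r)%N%:Z -> y (s - v) = x s.
    by move=> sK; rewrite -xy /shift_by ?subrK; lia.
  rewrite {1 2}/cluster_at /translate /dom /=.
  have [[s ys us]|b] := pselect (ball_around r [set s | linked r y 0 s] (u - v));
    last by rewrite windowF.
  have sK := hK _ _ _ Yy ys.
  move=> _; rewrite windowT; last by exists 0; [exact: linked_refl|lia].
  by rewrite /cluster_at windowT ?agr; [|lia|exists s].
have [q [Kq qR xq]] := hR2 x Yx x0; exists q; split.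
  by apply: linked_step (linked_refl _ _ _) _ xq; lia.
by move=> /(hK _ _ _ Yx); rewrite subr0; lia.
Qed.

Lemma cvg_agree (f : nat -> config) x :
  (forall N, \forall n \near \oo, agree N (f n) x) -> f @ \oo --> x.
Proof.
move=> h; apply/cvg_sup => u A.
move=> [_ [[B _ <-] Bx BA]].
suff : \forall n \near \oo, A (f n) by [].
apply: filterS (h `|u|%N) => n fx; apply: BA => /=.
by rewrite fx //; lia.
Qed.

(** * The dichotomy for sparse subshifts *)

Lemma cluster_fractal_of_minimal Y x : subshift Y -> sparse Y ->
  (forall x y, Y x -> Y y -> x 0 -> orbit_closure x y) ->
  (forall x, Y x -> finite_point x -> ~ nonzero x) ->
  Y x -> x 0 -> cluster_fractal x.
Proof.
move=> sY spY minY nofin Yx x0.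
have /choice[next nextP] r : exists r', next_radius Y r r'
  by exact: next_radius_exists.
pose rad i := iter i next 0%N.
pose B i : set pattern :=
  [set b | exists2 y, Y y /\ y 0 & b = cluster_at (rad i) y 0].
have radS i : (rad i < rad i.+1)%N by have [] := nextP (rad i).
split; first by exists 0.
exists rad, B; split=> //.
  move=> i; have [K hK] := linked_bounded (rad i) spY.
  have dom_bound b : B i b -> forall u, dom b u -> `|u| <= (K + rad i)%N%:Z.
    move=> [y [Yy y0] ->] u; rewrite dom_window => -[s /= ys us].
    by have := hK _ _ _ Yy ys; lia.
  split; first exact: sub_finite_set (finite_patterns (K + rad i)).
  move=> b Bb; split; last exact: finite_bounded (dom_bound b Bb).
  by have [y [Yy y0] ->] := Bb; exact: cluster_at_cluster.
split.
- move=> i c [y [Yy y0] ->]; have [K hK] := linked_bounded (rad i.+1) spY.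
  apply: (@gluing_of_clusters _ _ Y _ K) => //; first exact: ltnW.
  by move=> s /(hK _ _ _ Yy); rewrite subr0.
- move=> i c [y [Yy y0] ->] b [z [Yz z0] ->].
  by have [_ /(_ y Yy y0)[/(_ z Yz z0)]] := nextP (rad i).
- move=> i c [y [Yy y0] ->].
  have [_ /(_ y Yy y0)[_ [q [qy nqy]]]] := nextP (rad i).
  have yq := linked_on y0 qy.
  exists (cluster_at (rad i) y 0), (cluster_at (rad i) (shift_by q y) 0), 0, q.
  rewrite translate0 translate_cluster; split.
  + split; first by exists y.
    exists (shift_by q y) => //; split; first exact: (subshift_shift sY).
    by rewrite /shift_by add0r.
  + by apply: contains_cluster; [exact: ltnW|exact: linked_refl].
  + by apply: contains_cluster => //; exact: ltnW.
  + rewrite !supp_cluster //; apply/seteqP; split=> // s [ys qs]; apply: nqy.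
    by apply: linked_trans ys _; exact: linked_sym.
(* The cluster of [x] around 0 agrees with [x] up to distance [rad j >= j]. *)
- exists (fun=> 0), (fun j => cluster_at (rad j) x 0); split=> [j|].
    by exists x.
  apply: cvg_agree => N; exists N => // n /= Nn u uN.
  rewrite shift_by0 /extend_by_zero /cluster_at windowT //.
  exists 0; first exact: linked_refl.
  have : (n <= rad n)%N by elim: {Nn} n => // n IH; exact: leq_ltn_trans (radS n).
  by lia.
Qed.

Theorem finite_point_or_cluster_fractal X : subshift X -> sparse X ->
  (exists2 x, X x & nonzero x) ->
  (exists x, X x /\ finite_point x /\ nonzero x) \/
  (exists x, X x /\ cluster_fractal x).
Proof.
move=> sX spX [x Xx [u xu]].
have [|nofin] := pselect (exists x, X x /\ finite_point x /\ nonzero x).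
  by left.
right; have [|Y [sY YX [y Yy y0] minY]] := minimal_nonzero_subshift sX.
  exists (shift_by u x); first exact: (subshift_shift sX).
  by rewrite /shift_by add0r.
exists y; split; first exact: YX.
apply: (@cluster_fractal_of_minimal Y) => //.
  by move=> N; have [M hM] := spX N; exists M => z /YX; exact: hM.
by move=> z /YX Xz fz nz; apply: nofin; exists z.
Qed.

(** * The prime subshift *)

Lemma infinite_natP (A : set nat) :
  infinite_set A <-> forall K, exists2 n, A n & (K <= n)%N.
Proof.
split=> [iA K|h /finite_seqP[s sA]].
  apply: contrapT => nK; apply: iA.
  apply: (@sub_finite_set _ _ `I_K); last exact: finite_II.
  move=> n An /=; rewrite ltnNge; apply/negP => Kn; apply: nK; by exists n.
have [n An] := h (\max_(i <- s) i).+1.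
rewrite ltnNge leq_bigmax_seq //.
by move: An; rewrite sA.
Qed.

Lemma prime_subshift_subshift : subshift prime_subshift.
Proof.
split=> [y h m l|v x Xx m l].
  have [x Xx xy] := h (`|m| + l)%N.
  suff <- : subword x m l = subword y m l by exact: Xx.
  apply/eq_in_map => k; rewrite mem_iota => kl; apply: xy; lia.
have -> : subword (shift_by v x) m l = subword x (m + v) l; last exact: Xx.
by apply/eq_map => k; rewrite /shift_by addrAC.
Qed.

(** For [M = (N+1)!] and [q > 0], the [N] numbers [q M + 2, ..., q M + N + 1]
    are composite, and such a run starts in every interval of [M] large enough
    numbers. *)
Lemma prime_subshift_sparse : sparse prime_subshift.
Proof.
move=> N; pose M := ((N.+1)`!)%N; exists M => x Xx m.
have M0 : (0 < M)%N by exact: fact_gt0.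
have /infinite_natP/(_ M.+2)[n /= hn Mn] := Xx m (M + N)%N.
(* The offset [a < M] is such that [n + a] is congruent to 2 modulo [M]. *)
pose a := (M - 1 - (n - 3) %% M)%N.
pose q := ((n - 3) %/ M).+1.
have aM : (a < M)%N by rewrite /a; lia.
have naq : (n + a = q * M + 2)%N.
  have := divn_eq (n - 3) M; have := ltn_pmod (n - 3) M0.
  by rewrite /a /q; nia.
exists (m + a%:Z); split; first by lia.
move=> u /andP[u1 u2]; pose k := absz (u - (m + a%:Z))%R.
have kN : (k < N)%N by rewrite /k; lia.
have ak : (a + k < M + N)%N by lia.
have := hn (a + k)%N; rewrite size_mkseq nth_mkseq // => /(_ ak).
have -> : m + (a + k)%N%:Z = u by rewrite /k; lia.
move=> [_ h]; apply/negP => /h pr.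
have : (k.+2 %| n + (a + k))%N.
  rewrite addnA naq -addnA -[(2 + k)%N]/(k.+2) dvdn_addl //.
  by rewrite dvdn_mull // dvdn_fact.
by move/(prime_nt_dvdP pr) => /(_ isT); nia.
Qed.

(** A limit of indicators of the primes, recentered at primes [p n > n]. Each
    of its words appears in them around arbitrarily large integers, where
    truncation to nonnegative integers is not felt. *)
Lemma prime_subshift_nonzero : exists2 x, prime_subshift x & nonzero x.
Proof.
have /choice[p hp] n : exists p, (n < p)%N && prime p.
  by have [p np pr] := prime_above n; exists p; rewrite np.
pose f (n : nat) : config :=
  fun u => (0 <= u + (p n)%:Z) && prime (absz (u + (p n)%:Z)%R).
have [U [UU ooU]] := ultra_oo.
have [x hx] := ultra_limit f UU.
exists x; last first.
  exists 0; have [n /= <- //] := filter_ex (hx 0%N).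
  by have /andP[_ pr] := hp n; rewrite /f add0r.
move=> m l; apply/infinite_natP => K.
have UK : U [set n | (K + `|m| <= n)%N] by apply: ooU; exact: nbhs_infty_ge.
have [n [/= fx Kn]] := filter_ex (filterI (hx (`|m| + l)%N) UK).
have /andP[np pr] := hp n.
exists (absz (m + (p n)%:Z)%R); last by lia.
move=> a /=; rewrite size_mkseq => al.
rewrite nth_mkseq // -fx; last by lia.
have -> : (absz (m + (p n)%:Z)%R + a)%N = absz (m + a%:Z + (p n)%:Z)%R by lia.
by rewrite /f; have -> : 0 <= m + a%:Z + (p n)%:Z by lia.
Qed.

Theorem proposition1p10 :
  (exists x : config, prime_subshift x /\ finite_point x /\ nonzero x) \/
  (exists x : config, prime_subshift x /\ cluster_fractal x).
Proof.
exact: finite_point_or_cluster_fractal prime_subshift_subshift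
  prime_subshift_sparse prime_subshift_nonzero.
Qed.
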